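(* Let $K$ be a field, let $X$ be a non-empty set, and let $\mathbb{A}_K(X)$ be the free associative algebra over $K$ with basis $X$. Then: (1) if the characteristic of $K$ is zero, then the ring $\mathbb{Z}$ has a Diophantine interpretation in $\mathbb{A}_K(X)$; (2) if the characteristic $p$ of $K$ is positive, then the structure $\langle \mathbb{Z};+,\mid_p\rangle$ has a Diophantine interpretation in $\mathbb{A}_K(X)$.
   Context: For a positive integer $n$ and $x,y\in\mathbb{Z}$, $x\mid_n y$ means $y=xqn^f$ for some $q,f\in\mathbb{Z}$. An equation in an algebraic structure $\mathcal{M}$ is an equality of two terms in variables and constants from $\mathcal{M}$. A set $D\subseteq \mathcal{M}^n$ is e-definable (Diophantine) in $\mathcal{M}$ if there is a finite system of equations $\Sigma(x_1,\dots,x_n,y_1,\dots,y_m)$ over $\mathcal{M}$ such that $(a_1,\dots,a_n)\in D$ if and only if the system $\Sigma(a_1,\dots,a_n,y_1,\dots,y_m)$ in the variables $y_1,\dots,y_m$ has a solution in $\mathcal{M}$. A Diophantine interpretation (e-interpretation) of a structure $\mathcal{A}$ in $\mathcal{M}$ is a map $\phi:D\to\mathcal{A}$ with $D\subseteq\mathcal{M}^n$ for some $n$, such that: $\phi$ is onto; $D$ is e-definable in $\mathcal{M}$; the preimage under $\phi$ of the equality relation of $\mathcal{A}$ is e-definable in $\mathcal{M}$; and the preimage of the graph of every function and of every predicate of $\mathcal{A}$ is e-definable in $\mathcal{M}$. *)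

(* Defs.v *)
From mathcomp Require Import all_boot all_order all_algebra.
From mathcomp Require Export monalg.

Set Implicit Arguments.
Unset Strict Implicit.
Unset Printing Implicit Defensive.

Import GRing.Theory.

Local Open Scope ring_scope.

Record signature := Signature {
  fun_sym : Type;
  fun_arity : fun_sym -> nat;
  pred_sym : Type;
  pred_arity : pred_sym -> nat
}.

Record structure (S : signature) := Structure {
  carrier :> Type;
  fun_interp (s : fun_sym S) : ('I_(fun_arity s) -> carrier) -> carrier;
  pred_interp (s : pred_sym S) : ('I_(pred_arity s) -> carrier) -> Prop
}.

Section Equations.
Variables (S : signature) (M : structure S).

Inductive term (V : Type) :=
| Var of V
| Const of M
| App (s : fun_sym S) of ('I_(fun_arity s) -> term V).

Fixpoint eval (V : Type) (e : V -> M) (t : term V) : M :=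
  match t with
  | Var v => e v
  | Const c => c
  | App s ts => fun_interp (fun i => eval e (ts i))
  end.

(* Subsets of M^n are predicates on V -> M with V = 'I_n; other finite index
   types V are allowed so that (M^n)^k is ('I_k * 'I_n) -> M, with no
   flattening to M^(k * n).  In the system of r equations below, the variables
   inl v are the parameters and the variables inr j are the unknowns. *)
Definition e_definable (V : finType) (D : (V -> M) -> Prop) : Prop :=
  exists (m r : nat) (lhs rhs : 'I_r -> term (V + 'I_m)),
    forall a : V -> M,
      D a <-> exists b : 'I_m -> M,
        forall i : 'I_r,
          let env w := match w with inl v => a v | inr j => b j end in
          eval env (lhs i) = eval env (rhs i).

End Equations.

Section Interpretations.
Variables (S T : signature) (A : structure T) (M : structure S).

Definition preimage_rel n (D : ('I_n -> M) -> Prop) (phi : ('I_n -> M) -> A)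
    k (R : ('I_k -> A) -> Prop) (a : 'I_k * 'I_n -> M) : Prop :=
  (forall i, D (fun j => a (i, j))) /\ R (fun i => phi (fun j => a (i, j))).

Definition equality_rel (x : 'I_2 -> A) : Prop := x ord0 = x ord_max.

(* The last coordinate is the value of the function. *)
Definition graph_rel k (f : ('I_k -> A) -> A) (x : 'I_k.+1 -> A) : Prop :=
  x ord_max = f (fun i => x (lift ord_max i)).

(* The map D -> A is the restriction to D of phi, whose values outside D are
   irrelevant. *)
Definition is_e_interpretation n (D : ('I_n -> M) -> Prop)
    (phi : ('I_n -> M) -> A) : Prop :=
  [/\ forall x : A, exists2 a, D a & phi a = x,
      e_definable D,
      e_definable (preimage_rel D phi equality_rel),
      forall s : fun_sym T,
        e_definable (preimage_rel D phi (graph_rel (@fun_interp T A s))) &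
      forall s : pred_sym T,
        e_definable (preimage_rel D phi (@pred_interp T A s))].

Definition e_interpretable : Prop :=
  exists n (D : ('I_n -> M) -> Prop) (phi : ('I_n -> M) -> A),
    is_e_interpretation D phi.

End Interpretations.

Inductive ring_sym := Zero | One | Opp | Add | Mul.

Definition ring_arity (s : ring_sym) : nat :=
  match s with Zero | One => 0 | Opp => 1 | Add | Mul => 2 end.

Definition ring_sig : signature :=
  @Signature ring_sym ring_arity Empty_set (fun=> 0%N).

Definition ring_interp (R : pzRingType) (s : ring_sym) :
    ('I_(ring_arity s) -> R) -> R :=
  match s return ('I_(ring_arity s) -> R) -> R with
  | Zero => fun=> 0
  | One => fun=> 1
  | Opp => fun x => - x ord0
  | Add => fun x => x ord0 + x ord_max
  | Mul => fun x => x ord0 * x ord_max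
  end.

Definition ring_structure (R : pzRingType) : structure ring_sig :=
  @Structure ring_sig R (@ring_interp R) (fun s _ => match s with end).

(* The exponent f may be negative, hence the detour through the rationals. *)
Definition dvd_upto (n : nat) (x y : int) : Prop :=
  exists q f : int, y%:Q = x%:Q * q%:Q * (n%:Q ^ f).

Definition add_dvd_sig : signature :=
  @Signature unit (fun=> 2%N) unit (fun=> 2%N).

(* <Z; +, |_n> *)
Definition Z_add_dvd (n : nat) : structure add_dvd_sig :=
  @Structure add_dvd_sig int
    (fun _ (x : 'I_2 -> int) => x ord0 + x ord_max)
    (fun _ (x : 'I_2 -> int) => dvd_upto n (x ord0) (x ord_max)).

(* Noncommutative polynomials: the monoid algebra of the free monoid of words
   over X, with the empty word as unit. *)
Definition free_assoc_alg (K : fieldType) (X : choiceType) : nzRingType :=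
  {malg K[{fmonom X}]}.

(* Main.v *)
(* The centralizer of a variable t in K<X> is K[t], so a Diophantine set over
   K[t] is Diophantine over K<X>.  For a nonconstant f in K[t], the solutions of
   the Pell equation x^2 - f x y + y^2 = 1 are, up to sign, the pairs
   (U_{n+1}, U_n), n in Z, of consecutive terms of the Lucas sequence
   U_0 = 0, U_1 = 1, U_{n+1} = f U_n - U_{n-1}: if u + u^-1 = f, then
   U_n = (u^n - u^-n) / (u - u^-1).  The solutions for f = t encode Z, and the
   addition formulas for U define addition.
   In characteristic 0, U_n(2) = n, so multiplication is a congruence mod t - 2.
   In characteristic p, V_n = u^n + u^-n satisfies V_{n p^s} = V_n^(p^s), and
   U_n divides U_m iff n divides m; so n |_p m iff U_n divides the U_k with
   V_k = V_m^(p^s) for some s.  Finally, g = f^(p^s) for some s iff g is a V_k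
   over f and g + 1 is a V_j over f + 1, since V_k(T + 1) = V_k(T) + 1 forces k
   to be a power of p. *)

Require Import Defs.
From Stdlib Require Import FunctionalExtensionality ClassicalEpsilon.
From mathcomp Require Import all_boot all_order all_algebra.
From mathcomp Require Import ring zify.

Set Implicit Arguments.
Unset Strict Implicit.
Unset Printing Implicit Defensive.

Import GRing.Theory Num.Theory.

Local Open Scope ring_scope.

(** * Lucas sequences *)

Section LucasSequences.
Variable R : comNzRingType.
Implicit Types f x y : R.

Fixpoint lucas_pair f (n : nat) : R * R :=
  if n is m.+1 then
    let: (x, y) := lucas_pair f m in (f * x - y, x)
  else (1, 0).

(* With u + u^-1 = f, [lucasU f n] is (u^n - u^-n) / (u - u^-1) and
   [lucasV f n] is u^n + u^-n. *)
Definition lucasU f n : R :=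
  match n with
  | Posz m => (lucas_pair f m).2
  | Negz m => - (lucas_pair f m.+1).2
  end.

Definition lucasV f n : R := 2%:R * lucasU f (n + 1) - f * lucasU f n.

Lemma lucasU0 f : lucasU f 0 = 0. Proof. by []. Qed.
Lemma lucasU1 f : lucasU f 1 = 1. Proof. by []. Qed.

Lemma lucasUN f n : lucasU f (- n) = - lucasU f n.
Proof. by case: n => [[|n]|n] //=; rewrite ?oppr0 ?opprK. Qed.

Lemma lucasU_rec_nat f (n : nat) :
  lucasU f n.+2 = f * lucasU f n.+1 - lucasU f n.
Proof. by rewrite /=; case: (lucas_pair f n). Qed.

Lemma lucasU_rec f n : lucasU f (n + 1 + 1) = f * lucasU f (n + 1) - lucasU f n.
Proof.
case: n => [n|[|[|n]]].
- have -> : n%:Z + 1 + 1 = n.+2%:Z by lia.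
  have -> : n%:Z + 1 = n.+1%:Z by lia.
  exact: lucasU_rec_nat.
- by rewrite /=; ring.
- by rewrite /=; ring.
- have -> : Negz n.+2 + 1 + 1 = - n.+1%:Z by lia.
  have -> : Negz n.+2 + 1 = - n.+2%:Z by lia.
  have -> : Negz n.+2 = - n.+3%:Z by lia.
  rewrite !lucasUN [X in _ = _ - - X]lucasU_rec_nat; ring.
Qed.

Lemma lucasUB1 f n : lucasU f (n - 1) = f * lucasU f n - lucasU f (n + 1).
Proof. by have := lucasU_rec f (n - 1); rewrite !subrK => ->; ring. Qed.

(** The recurrence in n involves two consecutive terms, hence the simultaneous induction on the two
    formulas. *)
Lemma lucasUD1 f n m :
  lucasU f (n + m + 1) =
    lucasU f (n + 1) * lucasU f (m + 1) - lucasU f n * lucasU f m /\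
  lucasU f (n + m) = lucasU f n * lucasU f (m + 1) +
    lucasU f (n + 1) * lucasU f m - f * (lucasU f n * lucasU f m).
Proof.
elim/int_ind: n => [|n [IH1 IH2]|n [IH1 IH2]].
- by rewrite !add0r; split; rewrite /=; ring.
- have -> : n.+1%:Z = n%:Z + 1 by lia.
  have -> : n%:Z + 1 + m = n%:Z + m + 1 by lia.
  rewrite !lucasU_rec IH1 IH2; split; ring.
- have -> : - n.+1%:Z = - n%:Z - 1 by lia.
  have -> : - n%:Z - 1 + m = - n%:Z + m - 1 by lia.
  rewrite !subrK !lucasUB1 IH1 IH2; split; ring.
Qed.

Lemma lucasUD1E f n m :
  lucasU f (n + m + 1) =
    lucasU f (n + 1) * lucasU f (m + 1) - lucasU f n * lucasU f m.
Proof. by case: (lucasUD1 f n m). Qed.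

Lemma lucasUD f n m :
  lucasU f (n + m) = lucasU f n * lucasU f (m + 1) +
    lucasU f (n + 1) * lucasU f m - f * (lucasU f n * lucasU f m).
Proof. by case: (lucasUD1 f n m). Qed.

(** The form x^2 - f x y + y^2 is invariant under the index shift (x, y) -> (f x - y, x) and equals
    1 at (U_1, U_0) = (1, 0). *)
Lemma lucasU_pell f n :
  lucasU f (n + 1) ^+ 2 - f * lucasU f (n + 1) * lucasU f n
    + lucasU f n ^+ 2 = 1.
Proof.
elim/int_ind: n => [|n IH|n IH]; first by rewrite /=; ring.
- have -> : n.+1%:Z = n%:Z + 1 by lia.
  by rewrite -{}IH lucasU_rec; ring.
- have -> : - n.+1%:Z = - n%:Z - 1 by lia.
  by rewrite -{}IH !subrK !lucasUB1; ring.
Qed.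

(** Modulo f - 2 the recurrence reads a_(n+2) = 2 a_(n+1) - a_n, which a_n = n solves with the same
    initial values. *)
Lemma lucasU_mod f n : exists z, lucasU f n - n%:~R = (f - 2%:R) * z.
Proof.
suff [] : (exists z, lucasU f n - n%:~R = (f - 2%:R) * z) /\
          (exists z, lucasU f (n + 1) - (n + 1)%:~R = (f - 2%:R) * z) by [].
elim/int_ind: n => [|n [[z1 E1] [z2 E2]]|n [[z1 E1] [z2 E2]]].
- by split; exists 0; rewrite /=; ring.
- have -> : n.+1%:Z = n%:Z + 1 by lia.
  split; first by exists z2.
  exists (f * z2 + (n + 1)%:~R - z1).
  rewrite !lucasU_rec; move: E1 E2; rewrite !rmorphD /=.
  move=> /eqP; rewrite subr_eq => /eqP -> /eqP; rewrite subr_eq => /eqP ->; ring.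
- have -> : - n.+1%:Z = - n%:Z - 1 by lia.
  rewrite !subrK; split; last by exists z1.
  exists (f * z1 + (- n%:Z)%:~R - z2).
  rewrite !lucasUB1; move: E1 E2; rewrite !rmorphD /=.
  move=> /eqP; rewrite subr_eq => /eqP -> /eqP; rewrite subr_eq => /eqP ->.
  rewrite !rmorphN /=; ring.
Qed.

Lemma lucasVN f n : lucasV f (- n) = lucasV f n.
Proof.
rewrite /lucasV lucasUN.
have -> : - n + 1 = - (n - 1) by lia.
rewrite lucasUN lucasUB1; ring.
Qed.

Lemma lucasV_abs f n : lucasV f n = lucasV f `|n|%N.
Proof.
by case: n => m //; rewrite NegzE lucasVN abszN.
Qed.

Lemma lucasV0 f : lucasV f 0 = 2%:R. Proof. by rewrite /lucasV /=; ring. Qed.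
Lemma lucasV1 f : lucasV f 1 = f. Proof. by rewrite /lucasV /=; ring. Qed.

Lemma lucasV_rec f n : lucasV f (n + 1 + 1) = f * lucasV f (n + 1) - lucasV f n.
Proof. rewrite /lucasV !lucasU_rec; ring. Qed.

Lemma lucasV_rec_nat f (n : nat) :
  lucasV f n.+2 = f * lucasV f n.+1 - lucasV f n.
Proof.
have -> : n.+2%:Z = n%:Z + 1 + 1 by lia.
have -> : n.+1%:Z = n%:Z + 1 by lia.
exact: lucasV_rec.
Qed.

(* N and P, the companion matrix of X^2 - f X + 1 and its adjugate, play the
   roles of u and u^-1. *)
Lemma lucasV_mx f : exists N P : 'M[R]_2,
  N * P = P * N /\
  forall k : nat, N ^+ k + P ^+ k = (lucasV f k)%:M.
Proof.
pose N : 'M[R]_2 := \matrix_(i, j)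
  if i == ord0 then (if j == ord0 then f else -1) else (j == ord0)%:R.
pose P : 'M[R]_2 := f%:M - N.
have comNP : GRing.comm N P.
  by apply: commrB => //; exact: (comm_mx_scalar _ N).
have NP1 : N * P = 1.
  apply/matrixP=> i j; rewrite !mxE big_ord_recl big_ord1 !mxE.
  case: (unliftP ord0 i) => [i'|] ->; case: (unliftP ord0 j) => [j'|] ->;
  by rewrite ?ord1 /=; ring.
exists N, P; split=> // k.
suff [] : N ^+ k + P ^+ k = (lucasV f k)%:M /\
          N ^+ k.+1 + P ^+ k.+1 = (lucasV f k.+1)%:M by [].
elim: k => [|k [IH1 IH2]].
  rewrite lucasV0 lucasV1 !expr0 !expr1; split; last by rewrite addrC subrK.
  by rewrite -mulr2n -(raddfMn (@scalar_mx _ 2)).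
split=> //; rewrite lucasV_rec_nat raddfB /= -IH1 scalar_mxM -IH2.
have -> : f%:M = N + P by rewrite addrC subrK.
have PN1 : P * N = 1 by rewrite -comNP.
rewrite -[_ *m _]/((N + P) * (N ^+ k.+1 + P ^+ k.+1)) mulrDl !mulrDr -!exprS.
have -> : N * P ^+ k.+1 = P ^+ k by rewrite exprS mulrA NP1 mul1r.
have -> : P * N ^+ k.+1 = N ^+ k by rewrite exprS mulrA PN1 mul1r.
by rewrite [N ^+ k + P ^+ k.+2]addrC addrACA [P ^+ k + _]addrC addrK.
Qed.
End LucasSequences.

Lemma rmorph_lucasU (R S : comNzRingType) (h : {rmorphism R -> S}) f n :
  h (lucasU f n) = lucasU (h f) n.
Proof.
have hN (m : nat) : h (lucasU f m) = lucasU (h f) m.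
  suff [] : h (lucasU f m) = lucasU (h f) m /\
            h (lucasU f m.+1) = lucasU (h f) m.+1 by [].
  elim: m => [|m [IH1 IH2]]; first by rewrite !lucasU0 !lucasU1 rmorph0 rmorph1.
  by split=> //; rewrite !lucasU_rec_nat rmorphB rmorphM IH1 IH2.
by case: n => m //; rewrite NegzE !lucasUN rmorphN hN.
Qed.

Lemma rmorph_lucasV (R S : comNzRingType) (h : {rmorphism R -> S}) f n :
  h (lucasV f n) = lucasV (h f) n.
Proof. by rewrite /lucasV rmorphB !rmorphM rmorph_nat !rmorph_lucasU. Qed.

(** V_k is N^k + P^k for commuting matrices N and P, and in characteristic p the Frobenius map is
    additive on commuting elements. *)
Lemma lucasV_pchar (R : comNzRingType) (p : nat) (f : R) (k s : nat) :
  p \in [pchar R] -> lucasV f (k * p ^ s)%N = lucasV f k ^+ (p ^ s).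
Proof.
move=> pR; elim: s => [|s IH]; first by rewrite muln1 expr1.
rewrite expnSr mulnA exprM -{}IH.
set m := (k * p ^ s)%N; have [N [P [cNP defV]]] := lucasV_mx f.
have pM : p \in [pchar 'M[R]_2].
  rewrite inE (pcharf_prime pR) /= -(rmorph_nat (@scalar_mx _ 2)).
  by rewrite (pcharf0 pR) rmorph0.
have scalI : injective (@scalar_mx R 2).
  by move=> x y /matrixP /(_ ord0 ord0); rewrite !mxE eqxx.
apply: scalI; rewrite [RHS](rmorphXn (@scalar_mx _ 2)) /= -!defV.
rewrite -[RHS](pFrobenius_autE pM) pFrobenius_autD_comm; last first.
  by apply: commrX; apply/commr_sym/commrX.
by rewrite !pFrobenius_autE -!exprM.
Qed.

(** * Degrees of Lucas polynomials *)

Section LucasPolynomials.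
Variable K : fieldType.
Implicit Types f g x y : {poly K}.

Lemma size_natr_leq1 n : (size (n%:R : {poly K}) <= 1)%N.
Proof. by rewrite -polyC_natr size_polyC; case: (_ != _). Qed.

Lemma lucasV_comp f n : lucasV f n = lucasV 'X n \Po f.
Proof. by rewrite rmorph_lucasV /= comp_polyX. Qed.

Lemma size_lucasUX n : size (lucasU ('X : {poly K}) n) = `|n|%N.
Proof.
have sN (m : nat) : size (lucasU ('X : {poly K}) m) = m.
  suff [] : size (lucasU ('X : {poly K}) m) = m /\
            size (lucasU ('X : {poly K}) m.+1) = m.+1 by [].
  elim: m => [|m [IH1 IH2]]; first by rewrite lucasU0 lucasU1 size_poly0 size_poly1.
  split=> //; rewrite lucasU_rec_nat size_polyDl mulrC size_mulX -?size_poly_eq0 IH2 //.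
  by rewrite size_polyN IH1.
by case: n => m //; rewrite NegzE lucasUN size_polyN sN abszN.
Qed.

Lemma lucasVX_monic (n : nat) :
  size (lucasV ('X : {poly K}) n.+1) = n.+2 /\ lucasV ('X : {poly K}) n.+1 \is monic.
Proof.
(* The first bound is only an inequality because V_0 = 2 vanishes in characteristic 2. *)
suff H : [/\ size (lucasV ('X : {poly K}) n) <= n.+1,
     size (lucasV ('X : {poly K}) n.+1) = n.+2 &
     lucasV ('X : {poly K}) n.+1 \is monic]%N by case: H.
elim: n => [|n [IH1 IH2 IH3]].
  by rewrite lucasV0 lucasV1 size_polyX monicX size_natr_leq1.
have nz : lucasV ('X : {poly K}) n.+1 != 0 by rewrite -size_poly_eq0 IH2.
have lt : (size (- lucasV ('X : {poly K}) n) < size ('X * lucasV ('X : {poly K}) n.+1)%R)%N.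
  by rewrite size_polyN mulrC size_mulX // IH2 !ltnS (leq_trans IH1).
rewrite lucasV_rec_nat IH2; split=> //.
  by rewrite size_polyDl // mulrC size_mulX // IH2.
by rewrite monicE lead_coefDl // lead_coef_monicM ?monicX // -monicE.
Qed.

End LucasPolynomials.

(** * The Pell equation over K[t] *)

Section PellEquation.
Variable K : fieldType.
Implicit Types f g x y : {poly K}.

Definition pell f x y := x * x - f * x * y + y * y = 1.

(** Degrees in f x y = x^2 + y^2 - 1 give deg f + deg y <= deg x, so deg y < deg x as f is
    nonconstant. Then x (f y - x) = y^2 - 1 bounds the degree of f y - x. *)
Lemma pell_descent f x y : (1 < size f)%N -> pell f x y -> y != 0 ->
  (size y <= size x)%N -> (size (f * y - x)%R < size x)%N.
Proof.
move=> sf pxy y0 le.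
have x0 : x != 0 by apply: contraTneq le => ->; rewrite size_poly0 leqn0 size_poly_eq0.
have f0 : f != 0 by rewrite -size_poly_gt0; apply: leq_trans sf.
have xy0 : x * y != 0 by rewrite mulf_neq0.
have Efxy : f * (x * y) = x * x + (y * y - 1) by rewrite -pxy; ring.
have Exz : x * (f * y - x) = y * y - 1 by rewrite -pxy; ring.
have sy : (0 < size y)%N by rewrite size_poly_gt0.
have s1 : (size (y * y - 1)%R <= (size y + size y).-1)%N.
  apply: leq_trans (size_polyD _ _) _; rewrite geq_max size_mul // leqnn.
  by rewrite size_polyN size_poly1; lia.
have sxy : (size (x * x + (y * y - 1))%R <= (size x + size x).-1)%N.
  apply: leq_trans (size_polyD _ _) _; rewrite geq_max size_mul // leqnn.
  by apply: leq_trans s1 _; lia.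
rewrite -Efxy size_mul // size_mul // in sxy.
have [->|z0] := eqVneq (f * y - x) 0; first by rewrite size_poly0; lia.
rewrite -Exz size_mul // in s1; move: sf le sy s1 sxy.
by move: (size f) (size x) (size y) (size (f * y - x)) => a b c d; lia.
Qed.

(** Descent on the total size: replacing the larger entry by its conjugate root shifts the index by
    one, and a solution with a zero entry has 1 or -1 as its other entry. *)
Lemma pell_lucasU f x y : (1 < size f)%N -> pell f x y ->
  exists n (e : bool), x = (-1) ^+ e * lucasU f (n + 1) /\ y = (-1) ^+ e * lucasU f n.
Proof.
move=> sf; have [k le_k] := ubnP (size x + size y)%N.
elim: k => // k IH in x y le_k * => pxy.
have sqr1 (z : {poly K}) : z * z = 1 -> exists e : bool, z = (-1) ^+ e.
  move=> zz1; have /eqP : (z - 1) * (z + 1) = 0 by rewrite -[RHS](subrr (z * z)) {2}zz1; ring.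
  rewrite mulf_eq0 => /orP[|]; first by rewrite subr_eq0 => /eqP->; exists false.
  by rewrite addr_eq0 => /eqP->; exists true.
have [y0|y0] := eqVneq y 0.
  have [|e ->] := sqr1 x; first by rewrite -pxy y0; ring.
  by exists 0, e; rewrite y0 add0r lucasU1 lucasU0 mulr1 mulr0.
have [x0|x0] := eqVneq x 0.
  have [|e ->] := sqr1 y; first by rewrite -pxy x0; ring.
  (* Since (U_0, U_(-1)) = (0, -1), the sign is reversed. *)
  exists (-1), (~~ e); rewrite x0 addNr lucasU0 mulr0; split=> //.
  by rewrite lucasUN lucasU1; case: e; ring.
have [le|lt] := leqP (size y) (size x).
  have lt := pell_descent sf pxy y0 le.
  have [||n [e [Ey Ez]]] := IH y (f * y - x); first by lia.
    by rewrite /pell -[RHS]pxy; ring.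
  exists (n + 1), e; split=> //.
  by rewrite lucasU_rec mulrBr -Ez mulrCA -Ey; ring.
have pyx : pell f y x by rewrite /pell -[RHS]pxy; ring.
have {}lt := pell_descent sf pyx x0 (ltnW lt).
have [||n [e [Ez Ex]]] := IH (f * x - y) x; first by lia.
  by rewrite /pell -[RHS]pxy; ring.
exists (n - 1), e; rewrite subrK; split=> //.
by rewrite lucasUB1 mulrBr -Ez mulrCA -Ex; ring.
Qed.

(* The congruence selects one of the two solutions (x, y) and (-x, -y). *)
Definition normed_pell f x y :=
  pell f x y /\ exists z, x - y - 1 = (f - 2%:R) * z.

Lemma normed_pell_lucasU f n : normed_pell f (lucasU f (n + 1)) (lucasU f n).
Proof.
split; first by rewrite /pell -!expr2 lucasU_pell.
have [[z1 E1] [z2 E2]] := (lucasU_mod f (n + 1), lucasU_mod f n).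
exists (z1 - z2); rewrite mulrBr -E1 -E2 rmorphD /=; ring.
Qed.

Lemma normed_pellP f x y : (1 < size f)%N -> normed_pell f x y <->
  exists n, x = lucasU f (n + 1) /\ y = lucasU f n.
Proof.
move=> sf; split=> [[pxy [z Ez]]|[n [-> ->]]]; last exact: normed_pell_lucasU.
have [n [e [Ex Ey]]] := pell_lucasU sf pxy.
exists n; case: e Ex Ey => Ex Ey; last by rewrite Ex Ey !mul1r.
have [_ [w Ew]] := normed_pell_lucasU f n.
(* With the wrong sign, the congruences for (x, y) and for its negative add up to f - 2 dividing 2.
   As f - 2 is nonconstant, this forces 2 = 0, and then the two signs coincide. *)
have E2 : (f - 2%:R) * (- (z + w)) = 2%:R.
  by rewrite mulrN mulrDr -Ez -Ew Ex Ey; ring.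
have s2 := size_natr_leq1 K 2.
have sf2 : (1 < size (f - 2%:R)%R)%N.
  by rewrite size_polyDl ?size_polyN // (leq_ltn_trans s2).
have zw0 : - (z + w) = 0.
  apply: contraTeq s2 => zw0; rewrite -E2 -ltnNge size_mul //; last first.
    by rewrite -size_poly_gt0 (ltn_trans _ sf2).
  move: sf2 zw0; rewrite -size_poly_gt0.
  by move: (size (f - 2%:R)) (size (- (z + w))) => a b; lia.
have N1 : -1 = 1 :> {poly K}.
  by apply/eqP; rewrite -subr_eq0 -opprD -mulr2n -[1 *+ 2]E2 zw0 mulr0 oppr0.
by rewrite Ex Ey expr1 N1 !mul1r.
Qed.

(** This is the pair (U_2, U_1), whose associated value is V_1 = f. *)
Lemma normed_pell_base f : normed_pell f f 1.
Proof. by split; [rewrite /pell; ring | exists 1; ring]. Qed.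

End PellEquation.

(** * Frobenius powers as values of Lucas polynomials *)

Section Frobenius.
Variables (K : fieldType) (p : nat) (pK : p \in [pchar K]).
Implicit Types f g x y : {poly K}.

(** For nonconstant f these g are the V_n(f), written through V_n = 2 U_(n+1) - f U_n so that the
    condition is Diophantine. *)
Definition lucasV_value f g := exists x y, normed_pell f x y /\ g = 2%:R * x - f * y.

Definition frobenius_value f g := lucasV_value f g /\ lucasV_value (f + 1) (g + 1).

Lemma lucasV_valueV f n : lucasV_value f (lucasV f n).
Proof.
by exists (lucasU f (n + 1)), (lucasU f n); split; first exact: normed_pell_lucasU.
Qed.

Lemma lucasV_valueP f g : (1 < size f)%N -> lucasV_value f g ->
  exists k : nat, g = lucasV f k.
Proof.
move=> sf [x [y [/(normed_pellP _ _ sf) [n [-> ->]] ->]]].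
by exists `|n|%N; rewrite -lucasV_abs.
Qed.

(** This includes constant f, in particular f = V_0 = 2, which [frobenius_valueP] does not cover. *)
Lemma frobenius_value_refl f : frobenius_value f f.
Proof.
by split; [exists f, 1 | exists (f + 1), 1]; split;
  rewrite ?mulr1; try exact: normed_pell_base; ring.
Qed.

Lemma pchar_polyK : p \in [pchar {poly K}].
Proof. exact: (rmorph_pchar (@polyC K)). Qed.

(** V_(k+1) is monic of degree k + 1, so shifting X by 1 changes the coefficient of X^k by k + 1.
    This excludes V(X + 1) = V(X) + 1 at an index above 1 prime to p. *)
Lemma lucasV_shift_coef (k : nat) :
  let D := lucasV ('X + 1) k.+1 - lucasV 'X k.+1 : {poly K} in
  D`_k = k.+1%:R.
Proof.
suff [] : let D j := lucasV ('X + 1) j - lucasV 'X j : {poly K} in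
  [/\ (size (D k) <= k)%N, (size (D k.+1) <= k.+1)%N & (D k.+1)`_k = k.+1%:R] by [].
elim: k => [|k [IH0 IH1 IH2]] /=.
  rewrite !lucasV0 !lucasV1 subrr size_poly0 addrAC subrr add0r size_poly1.
  by split=> //; rewrite coef1.
(* At X^(k+1) the three terms on the right contribute k + 1, the leading coefficient 1, and 0. *)
have E : lucasV ('X + 1) k.+2 - lucasV 'X k.+2 =
    (lucasV ('X + 1) k.+1 - lucasV 'X k.+1) * 'X + lucasV ('X + 1) k.+1
    - (lucasV ('X + 1) k - lucasV 'X k) :> {poly K}.
  by rewrite !lucasV_rec_nat; ring.
have sX1 : size ('X + 1 : {poly K}) = 2 by rewrite -polyC1 size_XaddC.
have [sV mV] := lucasVX_monic K k.
have sV1 : size (lucasV ('X + 1 : {poly K}) k.+1) = k.+2.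
  by rewrite lucasV_comp size_comp_poly2.
have lV1 : (lucasV ('X + 1 : {poly K}) k.+1)`_k.+1 = 1.
  have := lead_coef_comp (lucasV 'X k.+1) (q := 'X + 1 : {poly K}).
  rewrite sX1 -lucasV_comp => /(_ isT); rewrite lead_coefE sV1 /= => ->.
  by rewrite (monicP mV) -polyC1 lead_coefXaddC expr1n mulr1.
split=> //.
  rewrite E; apply: leq_trans (size_polyD _ _) _; rewrite geq_max size_polyN.
  apply/andP; split; last exact: leq_trans IH0 (leqW (leqnSn _)).
  apply: leq_trans (size_polyD _ _) _; rewrite geq_max sV1 leqnn andbT.
  by apply: leq_trans (size_polyMleq _ _) _; rewrite size_polyX addn2.
rewrite E coefB coefD coefMX /= IH2 lV1 (nth_default _ (leqW IH0)) subr0.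
by rewrite [RHS]mulrSr.
Qed.

Lemma frobenius_valueP f g : (1 < size f)%N ->
  frobenius_value f g <-> exists s : nat, g = f ^+ (p ^ s).
Proof.
move=> sf; have pP := pchar_polyK; have p_pr := pcharf_prime pK.
have Vp h s : lucasV h (p ^ s)%N = h ^+ (p ^ s) :> {poly K}.
  by rewrite -[X in lucasV _ (Posz X)]mul1n lucasV_pchar // lucasV1.
have sf1 : size (f + 1) = size f by rewrite size_polyDl // size_poly1.
split=> [[/(lucasV_valueP sf) [k Eg]]|[s ->]]; last first.
  rewrite -Vp; split; first exact: lucasV_valueV.
  have -> : lucasV f (p ^ s)%N + 1 = lucasV (f + 1) (p ^ s)%N.
    rewrite !Vp exprDn_pchar ?expr1n //.
    by rewrite pnatX (eq_pnat _ (pcharf_eq pP)) pnat_id.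
  exact: lucasV_valueV.
move/(lucasV_valueP _); rewrite sf1 => /(_ sf) [j Eg1].
have sV (h : {poly K}) (i : nat) : (1 < size h)%N -> (0 < i)%N ->
    size (lucasV h i) = (i * (size h).-1).+1.
  move=> sh i0; rewrite lucasV_comp -(prednK i0); have [sVi mVi] := lucasVX_monic K i.-1.
  have : lucasV 'X i.-1.+1 \Po h != 0.
    by rewrite comp_poly_eq0 // -size_poly_eq0 sVi.
  by rewrite -size_poly_gt0 => /prednK <-; rewrite size_comp_poly sVi.
have s2 := size_natr_leq1 K.
(* For k = 0 one gets g + 1 = 3, a constant different from V_0 = 2, while the other V_j(f + 1) are
   nonconstant. *)
have k0 : (0 < k)%N.
  rewrite lt0n; apply/negP => /eqP k0; move: Eg1; rewrite Eg k0 lucasV0 => Eg1.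
  have [j0|j0] := posnP j.
    move/eqP: Eg1; rewrite j0 lucasV0 addrC -subr_eq0 addrK oner_eq0 //.
  have := s2 3; have -> : 3%:R = lucasV (f + 1) j by rewrite -Eg1 -mulrSr.
  by rewrite sV ?sf1 // ltnS leqn0 muln_eq0; lia.
have gt1 : (1 < size g)%N by rewrite Eg sV // ltnS muln_gt0 k0 -subn1 subn_gt0.
have sg1 : size (g + 1) = size g by rewrite size_polyDl // size_poly1.
have j0 : (0 < j)%N.
  rewrite lt0n; apply/negP => /eqP j0; move: gt1; rewrite -sg1 Eg1 j0 lucasV0.
  by rewrite ltnNge s2.
(* Adding 1 changes neither the degree of f nor that of g, and deg V_i(h) = i deg h. *)
have jk : j = k.
  move: sg1; rewrite Eg1 Eg !sV ?sf1 // => -[] /eqP; rewrite eqn_pmul2r -?subn1 ?subn_gt0 //.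
  by move/eqP.
have [s [k' pk' Ek]] : exists s, exists2 k', ~~ (p %| k')%N & k = (k' * p ^ s)%N.
  have [k' ck' Ek] := pfactor_coprime p_pr k0.
  by exists (logn p k), k'; rewrite // -prime_coprime.
exists s; have Fr (a b : {poly K}) : (a - b) ^+ (p ^ s) = a ^+ (p ^ s) - b ^+ (p ^ s).
  by elim: s {Ek} => // s IH; rewrite expnSr !exprM IH -!(pFrobenius_autE pP) rmorphB.
suff -> : g = lucasV f (1 * p ^ s)%N by rewrite mul1n Vp.
rewrite Eg Ek; suff -> : k' = 1%N by [].
have k'0 : (0 < k')%N by move: k0; rewrite Ek muln_gt0 => /andP[].
(* Since V_k is the p^s-th power of V_k', the relation V_k(f + 1) = V_k(f) + 1 is a p^s-th power of
   the same relation for k'. *)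
have E1 : (lucasV (f + 1) k' - lucasV f k' - 1) ^+ (p ^ s) = 0.
  rewrite (Fr (_ - _) 1) (Fr (lucasV _ _) (lucasV _ _)) expr1n.
  by rewrite -!(lucasV_pchar _ _ _ pP) -Ek -{1}jk -Eg1 -Eg; ring.
(* A nonconstant f is transcendental over K, so the relation already holds at X. *)
have : (lucasV ('X + 1) k' - lucasV 'X k' - 1) \Po f == 0.
  rewrite 2!comp_polyB !(rmorph_lucasV (comp_poly f)) /= comp_polyD comp_polyX.
  by rewrite -polyC1 comp_polyC; move/eqP: E1; rewrite expf_eq0 => /andP[].
rewrite comp_poly_eq0 // subr_eq0 => /eqP {}E1.
(* From here [k'] is one less than before. If it is positive, the coefficient of X^k' in the
   constant 1 is 0, so p divides k' + 1. *)
case: k' pk' k'0 E1 Ek => // k' pk' _ E1 _.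
have := lucasV_shift_coef k'; rewrite /= E1 coef1.
case: k' pk' {E1} => // k' pk' /esym/eqP.
by rewrite -(dvdn_pcharf pK) (negPf pk').
Qed.
End Frobenius.

(** * Divisibility up to powers of p *)

Lemma dvd_uptoP (n : nat) (x y : int) : (0 < n)%N ->
  dvd_upto n x y <-> exists (s : nat) (q : int), y * (n ^ s)%N = x * q.
Proof.
move=> n0; have nz : n%:Q != 0 by rewrite intr_eq0 eqz_nat -lt0n.
have natE s : ((n ^ s)%N : int)%:Q = n%:Q ^+ s by rewrite -!pmulrn natrX.
split=> [[q [f E]]|[s [q E]]].
  (* A nonnegative power of n is absorbed into the quotient; a negative one, of exponent -(s + 1),
     moves to the side of y. *)
  case: f => s in E.
    exists 0%N, (q * (n ^ s)%N); apply: (@intr_inj rat).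
    by rewrite !rmorphM /= !natE expr0 mulr1 E mulrA.
  exists s.+1, q; apply: (@intr_inj rat).
  rewrite !rmorphM /= natE E NegzE -exprnN.
  by rewrite divfK // expf_neq0.
exists q, (- s%:Z); rewrite -rmorphM -E rmorphM /= natE -exprnN.
by rewrite mulfK // expf_neq0.
Qed.

Section Divisibility.
Variable K : fieldType.
Implicit Types f g x y : {poly K}.

Lemma lucasU_dvdD f n a b :
  (exists z, lucasU f a = lucasU f n * z) -> (exists z, lucasU f b = lucasU f n * z) ->
  exists z, lucasU f (a + b) = lucasU f n * z.
Proof.
move=> [z Ez] [w Ew]; rewrite lucasUD Ez Ew.
exists (z * lucasU f (b + 1) + lucasU f (a + 1) * w - f * z * (lucasU f n * w)); ring.
Qed.

Lemma lucasU_dvdM f n q : exists z, lucasU f (n * q) = lucasU f n * z.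
Proof.
elim/int_ind: q => [|q IH|q IH].
- by exists 0; rewrite !mulr0 lucasU0.
- have -> : n * q.+1 = n * q + n by rewrite -addn1 PoszD mulrDr mulr1.
  by apply: lucasU_dvdD => //; exists 1; rewrite mulr1.
- have -> : n * - q.+1%:Z = n * - q%:Z + - n by rewrite -addn1 PoszD opprD mulrDr mulrN1.
  by apply: lucasU_dvdD => //; exists (-1); rewrite lucasUN mulrN1.
Qed.

(** If r is the remainder of m modulo n, then U_n divides U_r by the addition formula, and deg U_r <
    deg U_n forces U_r = 0, so r = 0. *)
Lemma lucasUX_dvdP n m :
  (exists z, lucasU ('X : {poly K}) m = lucasU 'X n * z) <-> exists q, m = n * q.
Proof.
split=> [Hm|[q ->]]; last exact: lucasU_dvdM.
have sU := size_lucasUX K.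
have [n0|n0] := eqVneq n 0.
  exists 0; case: Hm => z; rewrite n0 lucasU0 !mul0r => E.
  by have := sU m; rewrite E size_poly0 => /esym/eqP; rewrite absz_eq0 => /eqP.
exists (m %/ n)%Z; rewrite {1}(divz_eq m n) mulrC.
suff -> : (m %% n)%Z = 0 by rewrite addr0.
have : exists z, lucasU ('X : {poly K}) (m %% n)%Z = lucasU 'X n * z.
  have -> : (m %% n)%Z = m + n * (- (m %/ n)%Z) by rewrite mulrN [n * _]mulrC.
  by apply: lucasU_dvdD => //; exact: lucasU_dvdM.
move=> [z E]; apply/eqP; rewrite -absz_eq0 -sU E.
have [-> | z0] := eqVneq z 0; first by rewrite mulr0 size_poly0.
have Un0 : lucasU ('X : {poly K}) n != 0 by rewrite -size_poly_eq0 sU absz_eq0.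
have := sU (m %% n)%Z; rewrite E size_mul // sU.
have := ltz_mod m n0; have := modz_ge0 m n0; move: z0; rewrite -size_poly_gt0.
move: (size z) => sz; lia.
Qed.

Lemma lucasVX_inj n m : lucasV ('X : {poly K}) n = lucasV 'X m -> `|n|%N = `|m|%N.
Proof.
rewrite (lucasV_abs _ n) (lucasV_abs _ m).
have s2 := size_natr_leq1 K 2.
case: `|n|%N `|m|%N => [|i] [|j] //; rewrite ?lucasV0 => E.
- by have [H _] := lucasVX_monic K j; move: s2; rewrite E H.
- by have [H _] := lucasVX_monic K i; move: s2; rewrite -E H.
- have [H _] := lucasVX_monic K i; have [H' _] := lucasVX_monic K j.
  by move: H; rewrite E H' => -[->].
Qed.

Lemma dvd_upto_lucas (p : nat) n m : p \in [pchar K] ->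
  dvd_upto p n m <->
  exists g x y z, [/\ frobenius_value (lucasV 'X m) g, normed_pell 'X x y,
    g = 2%:R * x - 'X * y & y = lucasU ('X : {poly K}) n * z].
Proof.
move=> pK; have p0 : (0 < p)%N by rewrite prime_gt0 // (pcharf_prime pK).
have pP := pchar_polyK pK.
have sVm : m != 0 -> (1 < size (lucasV ('X : {poly K}) m))%N.
  by rewrite lucasV_abs -absz_eq0; case: `|m|%N => // i _; rewrite (lucasVX_monic K i).1.
rewrite dvd_uptoP //; split=> [[s [q E]]|].
  (* V_0 is constant, so [frobenius_valueP] does not apply; the witnesses are g = V_0 = 2 and (x, y)
     = (U_1, U_0). *)
  have [m0|m0] := eqVneq m 0.
    exists 2%:R, 1, 0, 0; rewrite m0 lucasV0; split; last by rewrite mulr0.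
    - exact: frobenius_value_refl.
    - exact: (normed_pell_lucasU 'X 0).
    - by rewrite mulr1 mulr0 subr0.
  exists (lucasV 'X (n * q)), (lucasU 'X (n * q + 1)), (lucasU 'X (n * q)).
  have [z Ez] := lucasU_dvdM 'X n q; exists z; split=> //; last exact: normed_pell_lucasU.
  apply/(frobenius_valueP pK _ (sVm m0)); exists s.
  by rewrite -E lucasV_abs abszM lucasV_pchar // -lucasV_abs.
have sX : (1 < size ('X : {poly K}))%N by rewrite size_polyX.
move=> [g [x [y [z [Fg /(normed_pellP _ _ sX) [k [-> ->]] Eg Ey]]]]].
have [q Ek] : exists q, k = n * q by apply/(@lucasUX_dvdP n k); exists z.
have [m0|m0] := eqVneq m 0; first by exists 0%N, 0; rewrite m0 mul0r mulr0.
have [s Es] := (frobenius_valueP pK _ (sVm m0)).1 Fg.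
have : lucasV ('X : {poly K}) (m * (p ^ s)%N) = lucasV 'X k.
  by rewrite -[RHS]Eg Es lucasV_abs abszM lucasV_pchar // -lucasV_abs.
move/lucasVX_inj => Emk; exists s.
(* V is even in its index, so k is known only up to sign; divisibility by n is insensitive to it. *)
have [->|->] : m * (p ^ s)%N = k \/ m * (p ^ s)%N = - k.
  by move: Emk; move: (m * _) => w; lia.
  by exists q.
by exists (- q); rewrite Ek mulrN.
Qed.

End Divisibility.

(** * Diophantine definability *)

Section Definability.
Variables (S : signature) (M : structure S).

Fixpoint rename_term (V W : Type) (h : V -> W) (t : term M V) : term M W :=
  match t with
  | Var v => Var M (h v)
  | Const c => Const W c
  | App s ts => App (fun i => rename_term h (ts i))
  end.

Lemma eval_rename (V W : Type) (h : V -> W) (e : W -> M) (t : term M V) :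
  eval e (rename_term h t) = eval (fun v => e (h v)) t.
Proof.
elim: t => //= s ts IH; congr (fun_interp _).
by apply: functional_extensionality => i; exact: IH.
Qed.

Definition sum_env (V W : Type) (a : V -> M) (b : W -> M) (w : V + W) : M :=
  match w with inl v => a v | inr j => b j end.

(** Unknowns and equations may be indexed by any finite types, such as sums and options; enumerating
    these gives the ordinals of the definition. *)
Lemma finType_e_definable (V : finType) (D : (V -> M) -> Prop) (J I : finType)
    (lhs rhs : I -> term M (V + J)) :
  (forall a, D a <-> exists b : J -> M, forall i,
     eval (sum_env a b) (lhs i) = eval (sum_env a b) (rhs i)) ->
  e_definable D.
Proof.
move=> HD; pose h (w : V + J) : V + 'I_#|J| :=
  match w with inl v => inl v | inr j => inr (enum_rank j) end.
exists #|J|, #|I|, (fun i => rename_term h (lhs (enum_val i))),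
  (fun i => rename_term h (rhs (enum_val i))) => a.
have envE b : (fun w => sum_env a b (h w)) = sum_env a (fun j => b (enum_rank j)).
  by apply: functional_extensionality => -[].
rewrite HD; split=> [[b Hb]|[b Hb]].
  exists (fun j => b (enum_val j)) => i /=; rewrite !eval_rename.
  rewrite -[X in eval X]/(fun w => sum_env a (fun j => b (enum_val j)) (h w)) envE.
  have -> : (fun j => b (enum_val (enum_rank j))) = b.
    by apply: functional_extensionality => j; rewrite enum_rankK.
  exact: Hb.
exists (fun j => b (enum_rank j)) => i.
have := Hb (enum_rank i); rewrite /= !eval_rename enum_rankK.
by rewrite -[X in eval X]/(fun w => sum_env a b (h w)) envE.
Qed.

(** Working with the functions that terms induce keeps syntax out of the definability proofs. *)
Definition term_fun (V : Type) (F : (V -> M) -> M) :=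
  exists t : term M V, forall a, F a = eval a t.

Lemma term_fun_var (V : Type) (v : V) : term_fun (fun a => a v).
Proof. by exists (Var M v). Qed.

Lemma term_fun_const (V : Type) (c : M) : term_fun (fun _ : V -> M => c).
Proof. by exists (Const V c). Qed.

Lemma term_fun_rename (V W : Type) (h : V -> W) F :
  term_fun F -> term_fun (fun a => F (fun v => a (h v))).
Proof. by move=> [t Ht]; exists (rename_term h t) => a; rewrite Ht eval_rename. Qed.

Lemma e_definable_ext (V : finType) (D E : (V -> M) -> Prop) :
  (forall a, D a <-> E a) -> e_definable D -> e_definable E.
Proof. by move=> DE [m [r [l [l' H]]]]; exists m, r, l, l' => a; rewrite -DE H. Qed.

Lemma e_definable_eq (V : finType) (F G : (V -> M) -> M) :
  term_fun F -> term_fun G -> e_definable (fun a => F a = G a).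
Proof.
move=> [t Ht] [u Hu].
apply: (@finType_e_definable _ _ void unit (fun=> rename_term inl t)
  (fun=> rename_term inl u)) => a.
split=> [E|[b /(_ tt)]]; last by rewrite !eval_rename Ht Hu.
by exists (of_void _) => _; rewrite !eval_rename /= -Ht -Hu.
Qed.

Lemma e_definable_and (V : finType) (D E : (V -> M) -> Prop) :
  e_definable D -> e_definable E -> e_definable (fun a => D a /\ E a).
Proof.
move=> [m [r [l [l' H]]]] [m2 [r2 [l2 [l2' H2]]]].
pose h (w : V + 'I_m) : V + ('I_m + 'I_m2) :=
  match w with inl v => inl v | inr j => inr (inl j) end.
pose h2 (w : V + 'I_m2) : V + ('I_m + 'I_m2) :=
  match w with inl v => inl v | inr j => inr (inr j) end.
pose L (k : 'I_r -> term M (V + 'I_m)) (k2 : 'I_r2 -> term M (V + 'I_m2))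
    (i : 'I_r + 'I_r2) :=
  match i with inl i => rename_term h (k i) | inr i => rename_term h2 (k2 i) end.
have hE a b : (fun w => sum_env a b (h w)) = sum_env a (fun j => b (inl j)).
  by apply: functional_extensionality => -[].
have h2E a b : (fun w => sum_env a b (h2 w)) = sum_env a (fun j => b (inr j)).
  by apply: functional_extensionality => -[].
apply: (@finType_e_definable _ _ _ _ (L l l2) (L l' l2')) => a.
rewrite H H2; split=> [[[b Hb] [b2 Hb2]]|[b Hb]].
  exists (sum_env b b2) => -[i|i] /=; rewrite !eval_rename ?hE ?h2E.
    exact: Hb.
  exact: Hb2.
split; [exists (fun j => b (inl j)) => i|exists (fun j => b (inr j)) => i].
  by have := Hb (inl i); rewrite /= !eval_rename hE.
by have := Hb (inr i); rewrite /= !eval_rename h2E.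
Qed.

Lemma e_definable_forall (V : finType) k (D : 'I_k -> (V -> M) -> Prop) :
  (forall i, e_definable (D i)) -> e_definable (fun a => forall i, D i a).
Proof.
elim: k D => [|k IH] D HD.
  apply: (@finType_e_definable _ _ void void (of_void _) (of_void _)) => a.
  by split=> _; [exists (of_void _) => -[] | case].
apply: e_definable_ext (e_definable_and (HD ord0) (IH _ (fun i => HD (lift ord0 i)))).
move=> a; split=> [[H0 H1] i|H]; last by split.
by case: (unliftP ord0 i) => [j|] ->.
Qed.

(** The bound variable, indexed by [None], becomes one more unknown of the same system. *)
Lemma e_definable_exists (V : finType) (D : (V -> M) -> M -> Prop) :
  e_definable (fun a : option V -> M => D (fun v => a (Some v)) (a None)) ->
  e_definable (fun a => exists b, D a b).
Proof.
move=> [m [r [l [l' H]]]].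
pose h (w : option V + 'I_m) : V + option 'I_m :=
  match w with
  | inl (Some v) => inl v | inl None => inr None | inr j => inr (Some j)
  end.
have hE a b : (fun w => sum_env a b (h w)) =
    sum_env (fun o => if o is Some v then a v else b None) (fun j => b (Some j)).
  by apply: functional_extensionality => -[[]|].
apply: (@finType_e_definable _ _ _ _ (fun i => rename_term h (l i))
  (fun i => rename_term h (l' i))) => a.
split=> [[b Dab]|[b Hb]].
  have [c Hc] := (H (fun o => if o is Some v then a v else b)).1 Dab.
  exists (fun o => if o is Some j then c j else b) => i.
  by rewrite !eval_rename hE; exact: Hc.
exists (b None).
apply: (H (fun o => if o is Some v then a v else b None)).2.
by exists (fun j => b (Some j)) => i; have := Hb i; rewrite !eval_rename hE.
Qed.

End Definability.

(** * Interpretations from injective codings *)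

Definition coded_rel (A M : Type) n (c : A -> 'I_n -> M) k
    (R : ('I_k -> A) -> Prop) (a : 'I_k * 'I_n -> M) : Prop :=
  exists xs, (forall i j, a (i, j) = c (xs i) j) /\ R xs.

Lemma e_interpretable_coding (S T : signature) (A : structure T) (M : structure S)
    (a0 : A) n (c : A -> 'I_n -> M) :
  injective c ->
  e_definable (fun a => exists x, forall j, a j = c x j) ->
  e_definable (coded_rel c (@equality_rel T A)) ->
  (forall s : fun_sym T, e_definable (coded_rel c (graph_rel (@fun_interp T A s)))) ->
  (forall s : pred_sym T, e_definable (coded_rel c (@pred_interp T A s))) ->
  e_interpretable A M.
Proof.
move=> c_inj; set D := (fun a => _) => defD defE defF defP.
(* Injectivity of [c] makes [phi] its inverse on the set of codes, so preimages under [phi] are the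
   coded relations. *)
pose phi a := epsilon (inhabits a0) (fun x => forall j, a j = c x j).
have phiE a x : (forall j, a j = c x j) -> phi a = x.
  move=> ax; apply: c_inj; apply: functional_extensionality => j; rewrite -ax.
  exact/esym/(epsilon_spec (inhabits a0) (fun x => forall j, a j = c x j) (ex_intro _ x ax)).
have defR k (R : ('I_k -> A) -> Prop) :
    e_definable (coded_rel c R) -> e_definable (preimage_rel D phi R).
  apply: e_definable_ext => a; split=> [[xs [axs Rxs]]|[/fin_all_exists [xs axs] Ra]].
    split=> [i|]; first by exists (xs i) => j; exact: axs.
    suff -> : (fun i => phi (fun j => a (i, j))) = xs by [].
    by apply: functional_extensionality => i; exact: phiE (axs i).
  exists xs; split=> //.
  suff <- : (fun i => phi (fun j => a (i, j))) = xs by [].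
  by apply: functional_extensionality => i; exact: phiE (axs i).
exists n, D, phi; split=> [x|||s|s] //; try exact: defR.
by exists (c x); [exists x | exact: phiE].
Qed.

Section RingDefinability.
Variable R : nzRingType.
Let M := ring_structure R.
Variable V : Type.
Implicit Types F G : (V -> M) -> R.

Lemma term_funD F G :
  term_fun (F : _ -> M) -> term_fun (G : _ -> M) -> term_fun (fun a => F a + G a : M).
Proof.
move=> [t Ht] [u Hu].
exists (@App ring_sig M V Add (fun i => if i == ord0 then t else u)) => a.
by rewrite Ht Hu.
Qed.

Lemma term_funM F G :
  term_fun (F : _ -> M) -> term_fun (G : _ -> M) -> term_fun (fun a => F a * G a : M).
Proof.
move=> [t Ht] [u Hu].
exists (@App ring_sig M V Mul (fun i => if i == ord0 then t else u)) => a.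
by rewrite Ht Hu.
Qed.

Lemma term_funN F : term_fun (F : _ -> M) -> term_fun (fun a => - F a : M).
Proof.
by move=> [t Ht]; exists (@App ring_sig M V Opp (fun=> t)) => a; rewrite Ht.
Qed.
End RingDefinability.

(** * The centralizer of a variable *)

Section Centralizer.
Variables (K : fieldType) (X : choiceType) (v : X).
Implicit Types (g : {malg K[{fmonom X}]}) (w : seq X).

Lemma FMonom_eq w w' : (FMonom w == FMonom w') = (w == w').
Proof. by apply/eqP/eqP => [[]|->]. Qed.

Definition free_var : free_assoc_alg K X :=
  << FMonom [:: v] >> : {malg K[{fmonom X}]}.

Local Notation t := free_var.

Lemma malgC_comm_var : commr_rmorph (@malgC {fmonom X} K) t.
Proof.
move=> c; rewrite /GRing.comm /t !malgM_def !fgmulUU mulr1 mul1r.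
by rewrite mul1m mulm1.
Qed.

Definition poly_embed : {rmorphism {poly K} -> free_assoc_alg K X} :=
  horner_morph malgC_comm_var.

Lemma poly_embedX : poly_embed 'X = t. Proof. exact: horner_morphX. Qed.

Lemma free_varX i :
  t ^+ i = << FMonom (nseq i v) >> :> {malg K[{fmonom X}]}.
Proof.
elim: i => [|i IH]; first by rewrite expr0 -fmoneE.
by rewrite exprS IH /t [LHS]malgM_def fgmulUU mulr1 /mmul /= fmmulE.
Qed.

Lemma poly_embedCXn (c : K) i :
  poly_embed (c *: 'X^i) = << c *g FMonom (nseq i v) >> :> {malg K[{fmonom X}]}.
Proof.
rewrite -mul_polyC rmorphM rmorphXn poly_embedX free_varX.
rewrite [poly_embed c%:P]horner_morphC [LHS]malgM_def fgmulUU mulr1.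
by rewrite mul1m.
Qed.

(** The powers of t are distinct words, so a polynomial can be read off its image; this gives
    injectivity of the embedding. *)
Lemma poly_embed_coef (P : {poly K}) i :
  (poly_embed P : {malg K[{fmonom X}]})@_(FMonom (nseq i v)) = P`_i.
Proof.
rewrite -{1}[P]coefK poly_def rmorph_sum raddf_sum /=.
have [lt|le] := ltnP i (size P).
  rewrite (bigD1 (Ordinal lt)) //= big1 => [|j /eqP ne].
    by rewrite poly_embedCXn mcoeffUU addr0.
  rewrite poly_embedCXn mcoeffU; case: eqP => // -[] /(congr1 size).
  by rewrite !size_nseq => ji; case: ne; apply: val_inj.
rewrite nth_default // big1 // => j _.
rewrite poly_embedCXn mcoeffU; case: eqP => // -[] /(congr1 size).
by rewrite !size_nseq => ji; have := ltn_ord j; rewrite ji ltnNge le.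
Qed.

Lemma poly_embed_inj : injective poly_embed.
Proof. by move=> P Q E; apply/polyP => i; rewrite -!poly_embed_coef E. Qed.

Lemma mcoeff_mul_var g w :
  ((g : free_assoc_alg K X) * t : {malg K[{fmonom X}]})@_(FMonom (rcons w v)) =
    g@_(FMonom w).
Proof.
rewrite {2}[g]monalgE [in LHS]malgM_def fgmulgU !raddf_sum /=; apply: eq_bigr => -[k] _.
by rewrite mulr1 !mcoeffU /mmul /= fmmulE /= cats1 !FMonom_eq eqseq_rcons eqxx andbT.
Qed.

Lemma mcoeff_var_mul g y w :
  (t * (g : free_assoc_alg K X) : {malg K[{fmonom X}]})@_(FMonom (y :: w)) =
    if y == v then g@_(FMonom w) else 0.
Proof.
rewrite {2}[g]monalgE [in LHS]malgM_def fgmulUg !raddf_sum /=.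
case: eqP => [->|/eqP yv].
  apply: eq_bigr => -[k] _.
  by rewrite mul1r !mcoeffU /mmul /= fmmulE /= !FMonom_eq eqseq_cons eqxx.
rewrite big1 // => -[k] _.
by rewrite mcoeffU /mmul /= fmmulE /= FMonom_eq eqseq_cons eq_sym (negPf yv).
Qed.

(* Commuting with the variable v makes the support invariant under cyclic
   rotation of words, and every word of the support begins with v. *)
Lemma rotation_invariant_words (c : pred (seq X)) :
  (forall y w, c (y :: w) -> y = v /\ c (rcons w v)) ->
  forall w, c w -> w = nseq (size w) v.
Proof.
move=> rotc w cw; apply/all_pred1P/(all_nthP v) => i.
(* Letter i + 1 of y :: w is letter i of its rotation, to which the induction hypothesis applies. *)
elim: i w cw => [|i IH] [|y w] //= /rotc [yv cw] lt.
  by rewrite yv /=.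
have := IH _ cw; rewrite size_rcons nth_rcons => /(_ (ltnW lt)).
by rewrite -ltnS lt.
Qed.

Lemma centralizer_var (z : free_assoc_alg K X) :
  z * t = t * z <-> exists P, z = poly_embed P.
Proof.
split=> [zt|[P ->]]; last first.
  by rewrite -poly_embedX -[LHS]rmorphM mulrC rmorphM.
pose c w := (z : {malg K[{fmonom X}]})@_(FMonom w) != 0.
have {zt} supp : forall w, c w -> w = nseq (size w) v.
  apply: rotation_invariant_words => y w; rewrite /c.
  (* The coefficient of y w v in z t is that of y w in z; in t z it is that of w v in z if y = v,
     and 0 otherwise. *)
  have := mcoeff_mul_var z (y :: w); rewrite zt rcons_cons mcoeff_var_mul.
  by clear; case: eqP => [-> <- //|_ <-]; rewrite eqxx.
(* Every word of the support is a power of v, so its length is the exponent of t. *)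
exists (\sum_(k <- finmap.enum_fset (msupp (z : {malg K[{fmonom X}]})))
          (z : {malg K[{fmonom X}]})@_k *: 'X^(size k)).
rewrite [LHS](monalgE z) rmorph_sum /= big_seq [RHS]big_seq.
apply: eq_bigr => -[w] wg; rewrite poly_embedCXn -supp //.
by rewrite /c mcoeff_neq0.
Qed.
End Centralizer.

(** * Definability over K[t] *)

Section PolynomialDefinability.
Variables (K : fieldType) (X : choiceType) (v : X).
Let M := ring_structure (free_assoc_alg K X).
Notation iota := (poly_embed K v).

Definition poly_term_fun (V : Type) (F : (V -> {poly K}) -> {poly K}) :=
  exists2 G : (V -> M) -> M, term_fun G &
    forall P, iota (F P) = G (fun w => iota (P w)).

(** [E] is unconstrained outside the image of K[t]; commutation with t is imposed only when a
    variable is quantified or the relation is carried back to the algebra. *)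
Definition poly_definable (V : finType) (D : (V -> {poly K}) -> Prop) :=
  exists2 E : (V -> M) -> Prop, e_definable E &
    forall P, D P <-> E (fun w => iota (P w)).

Section TermFunctions.
Variable V : Type.
Implicit Types F G : (V -> {poly K}) -> {poly K}.

Lemma poly_term_fun_var (w : V) : poly_term_fun (fun P => P w).
Proof. by exists (fun a => a w) => //; exact: term_fun_var. Qed.

Lemma poly_term_fun_const (c : {poly K}) : poly_term_fun (fun _ : V -> {poly K} => c).
Proof. by exists (fun=> iota c) => //; exact: term_fun_const. Qed.

Lemma poly_term_fun_rename (W : Type) (h : V -> W) F :
  poly_term_fun F -> poly_term_fun (fun P => F (fun w => P (h w))).
Proof.
move=> [G dG FG]; exists (fun a => G (fun w => a (h w))).
  exact: term_fun_rename.
by move=> P; rewrite FG.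
Qed.

Lemma poly_term_funD F G :
  poly_term_fun F -> poly_term_fun G -> poly_term_fun (fun P => F P + G P).
Proof.
move=> [F' dF EF] [G' dG EG].
exists (fun a => (F' a : free_assoc_alg K X) + G' a); first exact: term_funD.
by move=> P /=; rewrite rmorphD EF EG.
Qed.

Lemma poly_term_funM F G :
  poly_term_fun F -> poly_term_fun G -> poly_term_fun (fun P => F P * G P).
Proof.
move=> [F' dF EF] [G' dG EG].
exists (fun a => (F' a : free_assoc_alg K X) * G' a); first exact: term_funM.
by move=> P /=; rewrite rmorphM EF EG.
Qed.

Lemma poly_term_funN F : poly_term_fun F -> poly_term_fun (fun P => - F P).
Proof.
move=> [F' dF EF]; exists (fun a => - (F' a : free_assoc_alg K X)); first exact: term_funN.
by move=> P /=; rewrite rmorphN EF.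
Qed.

End TermFunctions.

Section Formulas.
Variable V : finType.

Lemma poly_definable_eq (F G : (V -> {poly K}) -> {poly K}) :
  poly_term_fun F -> poly_term_fun G -> poly_definable (fun P => F P = G P).
Proof.
move=> [F' dF EF] [G' dG EG]; exists (fun a => F' a = G' a); first exact: e_definable_eq.
move=> P /=; rewrite -EF -EG; split; [by move=> -> | exact: poly_embed_inj].
Qed.

Lemma poly_definable_and (D E : (V -> {poly K}) -> Prop) :
  poly_definable D -> poly_definable E -> poly_definable (fun P => D P /\ E P).
Proof.
move=> [D' dD DD'] [E' dE EE']; exists (fun a => D' a /\ E' a); first exact: e_definable_and.
by move=> P /=; rewrite DD' EE'.
Qed.

Lemma poly_definable_forall k (D : 'I_k -> (V -> {poly K}) -> Prop) :
  (forall i, poly_definable (D i)) -> poly_definable (fun P => forall i, D i P).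
Proof.
move=> HD.
have [i|E HE] := @fin_all_exists 'I_k (fun=> (V -> M) -> Prop)
    (fun i E => e_definable E /\ forall P, D i P <-> E (fun w => iota (P w))).
  by have [E dE DE] := HD i; exists E.
exists (fun a => forall i, E i a); first by apply: e_definable_forall => i; case: (HE i).
by move=> P; split=> H i; apply/(HE i).2.
Qed.

(** The quantifier over K[t] is a quantifier over the algebra, relativized by the equation b t = t
    b. *)
Lemma poly_definable_exists (D : (V -> {poly K}) -> {poly K} -> Prop) :
  poly_definable (fun P : option V -> {poly K} => D (fun w => P (Some w)) (P None)) ->
  poly_definable (fun P => exists Q, D P Q).
Proof.
move=> [E dE DE]; pose t : free_assoc_alg K X := free_var K v.
pose ext (a : V -> M) (b : M) (w : option V) := if w is Some u then a u else b.
exists (fun a => exists b : M, b * t = t * b :> free_assoc_alg K X /\ E (ext a b)).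
  apply: e_definable_exists; apply: e_definable_and.
    apply: e_definable_eq; apply: term_funM;
      first [exact: term_fun_var | exact: term_fun_const].
  apply: e_definable_ext dE => a; suff -> : ext (fun w => a (Some w)) (a None) = a by [].
  by apply: functional_extensionality => -[].
move=> P; have extE Q :
    ext (fun w => iota (P w)) (iota Q) = fun w => iota (if w is Some u then P u else Q).
  by apply: functional_extensionality => -[].
split=> [[Q DPQ]|[b [/centralizer_var [Q ->]]]].
  exists (iota Q); split; first by apply/centralizer_var; exists Q.
  by rewrite extE; exact: (DE (fun w => if w is Some u then P u else Q)).1 DPQ.
by rewrite extE => /DE DPQ; exists Q.
Qed.

Lemma e_definable_poly (D : (V -> {poly K}) -> Prop) : poly_definable D ->
  e_definable (fun a : V -> M => exists2 P, forall w, a w = iota (P w) & D P).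
Proof.
move=> [E dE DE]; pose t : free_assoc_alg K X := free_var K v.
apply: (@e_definable_ext _ _ _ (fun a : V -> M =>
   (forall i : 'I_#|V|, a (enum_val i) * t = t * a (enum_val i) :> free_assoc_alg K X)
   /\ E a)).
  move=> a; split=> [[aB Ea]|[P aP /DE EP]].
    have [w|P aP] := @fin_all_exists V (fun=> {poly K}) (fun w Q => a w = iota Q).
      by apply/centralizer_var; have := aB (enum_rank w); rewrite enum_rankK.
    by exists P => //; apply/DE; rewrite -(functional_extensionality _ _ aP).
  rewrite (functional_extensionality _ _ aP); split; last exact: EP.
  move=> i.
  by apply/centralizer_var; exists (P (enum_val i)).
apply: e_definable_and => //; apply: e_definable_forall => i.
by apply: e_definable_eq; apply: term_funM;
  first [exact: term_fun_var | exact: term_fun_const].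
Qed.

End Formulas.
End PolynomialDefinability.

(** The last case treats a term function placed under further quantifiers, where its variables are
    renamed by [Some]. *)
Ltac solve_poly_term :=
  match goal with
  | H : poly_term_fun _ ?F |- poly_term_fun _ ?F => exact H
  | |- poly_term_fun _ (fun P => _ + _) => apply: poly_term_funD; solve_poly_term
  | |- poly_term_fun _ (fun P => _ * _) => apply: poly_term_funM; solve_poly_term
  | |- poly_term_fun _ (fun P => - _) => apply: poly_term_funN; solve_poly_term
  | |- _ => exact: poly_term_fun_const
  | |- _ => exact: poly_term_fun_var
  | |- _ => apply: poly_term_fun_rename; solve_poly_term
  end.

Ltac solve_poly_definable :=
  repeat first
    [ apply: poly_definable_and
    | apply: poly_definable_exists; cbn beta iota
    | apply: poly_definable_eq; solve_poly_term ].

Section Relations.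
Variables (K : fieldType) (X : choiceType) (v : X).

Lemma normed_pell_definable (V : finType) (F G H : (V -> {poly K}) -> {poly K}) :
  poly_term_fun v F -> poly_term_fun v G -> poly_term_fun v H ->
  poly_definable v (fun P => normed_pell (F P) (G P) (H P)).
Proof. by move=> dF dG dH; rewrite /normed_pell /pell; solve_poly_definable. Qed.

Lemma frobenius_value_definable (V : finType) (F G : (V -> {poly K}) -> {poly K}) :
  poly_term_fun v F -> poly_term_fun v G ->
  poly_definable v (fun P => frobenius_value (F P) (G P)).
Proof. by move=> dF dG; rewrite /frobenius_value /lucasV_value; solve_poly_definable. Qed.
End Relations.

(** * Coding the integers *)

Section Coding.
Variables (K : fieldType) (X : choiceType) (v : X).
Let M := ring_structure (free_assoc_alg K X).

Definition int_code (n : int) (j : 'I_2) : {poly K} :=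
  if j == ord0 then lucasU 'X (n + 1) else lucasU 'X n.

Definition alg_code (n : int) (j : 'I_2) : M := poly_embed K v (int_code n j).

(** The sizes |n + 1| and |n| of the two entries together determine n; |n| alone would leave the
    sign open. *)
Lemma int_code_inj n m : (forall j, int_code n j = int_code m j) -> n = m.
Proof.
move=> E; have := congr1 (size \o polyseq) (E ord0).
have := congr1 (size \o polyseq) (E ord_max).
by rewrite /int_code /= !size_lucasUX; lia.
Qed.

Lemma alg_code_inj : injective alg_code.
Proof.
move=> n m E; apply: int_code_inj => j.
by apply: (@poly_embed_inj K X v); exact: (congr1 (@^~ j) E).
Qed.

Lemma int_codeP (P : 'I_2 -> {poly K}) :
  normed_pell 'X (P ord0) (P ord_max) <-> exists n, forall j, P j = int_code n j.
Proof.
rewrite normed_pellP ?size_polyX //; split=> [[n [E0 E1]]|[n E]]; exists n.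
  by move=> j; rewrite /int_code; case: (unliftP ord0 j) => [i|] -> //=;
    rewrite -E1 ord1; congr (P _); apply: val_inj.
by rewrite !E.
Qed.

(** [D] has to agree with [R] on codes only, because the Pell conditions added in [E] restrict every
    pair to a code. *)
Lemma coded_rel_definable k (R : ('I_k -> int) -> Prop)
    (D : ('I_k * 'I_2 -> {poly K}) -> Prop) :
  poly_definable v D -> (forall xs, R xs <-> D (fun ij => int_code (xs ij.1) ij.2)) ->
  e_definable (coded_rel alg_code R).
Proof.
move=> dD RD.
pose E (P : 'I_k * 'I_2 -> {poly K}) :=
  (forall i, normed_pell 'X (P (i, ord0)) (P (i, ord_max))) /\ D P.
have dE : poly_definable v E.
  apply: poly_definable_and => //; apply: poly_definable_forall => i.
  by apply: normed_pell_definable; solve_poly_term.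
apply: e_definable_ext (e_definable_poly dE) => a; split=> [[P aP [PB DP]]|[xs [axs Rxs]]].
  have [i|xs Pxs] := @fin_all_exists 'I_k (fun=> int)
      (fun i n => forall j, P (i, j) = int_code n j).
    exact/(int_codeP (fun j => P (i, j))).
  exists xs; split=> [i j|]; first by rewrite aP Pxs.
  apply/RD; suff <- : P = fun ij => int_code (xs ij.1) ij.2 by [].
  by apply: functional_extensionality => -[i j]; exact: Pxs.
exists (fun ij => int_code (xs ij.1) ij.2); first by case.
split; last exact/RD.
by move=> i; apply/(int_codeP (fun j => int_code (xs i) j)); exists (xs i).
Qed.

Lemma e_interpretable_int (T : signature)
    (F : forall s : fun_sym T, ('I_(fun_arity s) -> int) -> int)
    (P : forall s : pred_sym T, ('I_(pred_arity s) -> int) -> Prop) :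
  (forall s, e_definable (coded_rel alg_code (graph_rel (A := Structure F P) (F s)))) ->
  (forall s, e_definable (coded_rel alg_code (P s))) ->
  e_interpretable (Structure F P) M.
Proof.
move=> dF dP; apply: (@e_interpretable_coding _ _ (Structure F P) M (0 : int) 2 alg_code) => //.
- exact: alg_code_inj.
- have dE : poly_definable v (fun P : 'I_2 -> {poly K} =>
      normed_pell 'X (P ord0) (P ord_max)).
    by apply: normed_pell_definable; solve_poly_term.
  apply: e_definable_ext (e_definable_poly dE) => a.
  split=> [[Q aQ /int_codeP [n Qn]]|[n an]].
    by exists n => j; rewrite aQ Qn.
  exists (int_code n); first exact: an.
  by apply/int_codeP; exists n.
- apply: (coded_rel_definable (D := fun P =>
    P (ord0, ord0) = P (ord_max, ord0) /\ P (ord0, ord_max) = P (ord_max, ord_max))).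
    by solve_poly_definable.
  move=> xs; rewrite /equality_rel /=; split=> [->|[E0 E1]] //.
  apply: int_code_inj => j; case: (unliftP ord0 j) => [i|] -> //.
Qed.

Lemma int_add_definable : e_definable (coded_rel alg_code
  (fun x : 'I_3 -> int => x ord_max = x (lift ord_max ord0) + x (lift ord_max ord_max))).
Proof.
pose i : 'I_3 := lift ord_max (ord0 : 'I_2); pose j : 'I_3 := lift ord_max (ord_max : 'I_2).
apply: (coded_rel_definable (D := fun P =>
  P (ord_max, ord0) = P (i, ord0) * P (j, ord0) + - (P (i, ord_max) * P (j, ord_max)) /\
  P (ord_max, ord_max) = P (i, ord_max) * P (j, ord0) + P (i, ord0) * P (j, ord_max)
    + - ('X * (P (i, ord_max) * P (j, ord_max))))).
  by solve_poly_definable.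
move=> xs; rewrite /= /int_code /= -lucasUD1E -lucasUD; split=> [->|[E0 E1]] //.
apply: int_code_inj => k; rewrite /int_code; case: ifP => _; [exact: E0 | exact: E1].
Qed.

Lemma int_dvd_definable p : p \in [pchar K] ->
  e_definable (coded_rel alg_code
  (fun x : 'I_2 -> int => dvd_upto p (x ord0) (x ord_max))).
Proof.
move=> pK.
(* The first argument of [frobenius_value] is V_m computed from the code of m. *)
apply: (coded_rel_definable (D := fun P => exists g x y z,
  frobenius_value (2%:R * P (ord_max, ord0) + - ('X * P (ord_max, ord_max))) g /\
  normed_pell 'X x y /\ g = 2%:R * x + - ('X * y) /\ y = P (ord0, ord_max) * z)).
  do 4!(apply: poly_definable_exists => /=).
  apply: poly_definable_and; first by apply: frobenius_value_definable; solve_poly_term.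
  apply: poly_definable_and; first by apply: normed_pell_definable; solve_poly_term.
  by solve_poly_definable.
move=> xs; rewrite (dvd_upto_lucas _ _ pK) /int_code /=.
by split=> -[g [x [y [z]]]]; [move=> [] * | move=> [? [? []]]]; exists g, x, y, z.
Qed.

Lemma int_zero_definable :
  e_definable (coded_rel alg_code (fun x : 'I_1 -> int => x ord_max = 0)).
Proof.
apply: (coded_rel_definable (D := fun P =>
  P (ord_max, ord0) = 1 /\ P (ord_max, ord_max) = 0)); first by solve_poly_definable.
move=> xs; rewrite /= /int_code /=; split=> [->|[E0 E1]] //.
by apply: int_code_inj => j; rewrite /int_code; case: ifP.
Qed.

Lemma int_one_definable :
  e_definable (coded_rel alg_code (fun x : 'I_1 -> int => x ord_max = 1)).
Proof.
have U2 : lucasU ('X : {poly K}) (1 + 1) = 'X by rewrite /=; ring.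
apply: (coded_rel_definable (D := fun P =>
  P (ord_max, ord0) = 'X /\ P (ord_max, ord_max) = 1)); first by solve_poly_definable.
move=> xs; rewrite /= /int_code /=; split=> [->|[E0 E1]] //.
by apply: int_code_inj => j; rewrite /int_code; case: ifP; rewrite ?U2.
Qed.

Lemma int_opp_definable :
  e_definable (coded_rel alg_code
  (fun x : 'I_2 -> int => x ord_max = - x (lift ord_max ord0))).
Proof.
pose i : 'I_2 := lift ord_max (ord0 : 'I_1).
apply: (coded_rel_definable (D := fun P =>
  P (ord_max, ord0) = P (i, ord0) + - ('X * P (i, ord_max)) /\
  P (ord_max, ord_max) = - P (i, ord_max))); first by solve_poly_definable.
move=> xs; rewrite /= /int_code /= -lucasUN -/i.
(* The first entry of the code of -n is U_(1-n) = -U_(n-1), and the recurrence expresses U_(n-1)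
   through the code of n. *)
have <- : lucasU 'X (- xs i + 1) =
    lucasU 'X (xs i + 1) + - ('X * lucasU 'X (xs i)) :> {poly K}.
  have -> : - xs i + 1 = - (xs i - 1) by lia.
  by rewrite lucasUN lucasUB1; ring.
split=> [->|[E0 E1]] //.
apply: int_code_inj => k; rewrite /int_code; case: ifP => _; [exact: E0 | exact: E1].
Qed.

(** * Multiplication in characteristic zero *)

Lemma horner_lucasU2 n : (lucasU ('X : {poly K}) n).[2%:R] = n%:~R.
Proof.
rewrite -[LHS]/(horner_eval 2%:R _) rmorph_lucasU /= /horner_eval hornerX.
(* At f = 2 the congruence modulo f - 2 is an equality. *)
by have [z] := lucasU_mod (2%:R : K) n; rewrite subrr mul0r => /eqP; rewrite subr_eq0 => /eqP.
Qed.

Hypothesis char0 : [pchar K] =i pred0.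

Lemma pchar0_intr_eq0 (n : int) : (n%:~R == 0 :> K) = (n == 0).
Proof.
have natr0 := (pcharf0P K).1 char0.
case: n => m; first exact: natr0.
by rewrite NegzE mulrNz !oppr_eq0; exact: natr0.
Qed.

Lemma int_mul_definable : e_definable (coded_rel alg_code
  (fun x : 'I_3 -> int => x ord_max = x (lift ord_max ord0) * x (lift ord_max ord_max))).
Proof.
pose i : 'I_3 := lift ord_max (ord0 : 'I_2); pose j : 'I_3 := lift ord_max (ord_max : 'I_2).
apply: (coded_rel_definable (D := fun P => exists z,
  P (ord_max, ord_max) + - (P (i, ord_max) * P (j, ord_max)) = z * ('X + - 2%:R%:P))).
  by solve_poly_definable.
move=> xs; rewrite /= /int_code /= -/i -/j.
(* Evaluation at 2 turns the polynomial into the image in K of an integer, which vanishes only if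
   the integer does; by the factor theorem, a root at 2 is divisibility by X - 2. *)
have <- : root (lucasU 'X (xs ord_max) - lucasU 'X (xs i) * lucasU 'X (xs j)) (2%:R : K)
    <-> xs ord_max = xs i * xs j.
  rewrite /root hornerD hornerN hornerM !horner_lucasU2 -rmorphM -rmorphB /=.
  by rewrite pchar0_intr_eq0 subr_eq0; split=> /eqP.
split=> [/factor_theorem [z E]|[z E]]; first by exists z.
by apply/factor_theorem; exists z.
Qed.

End Coding.

Theorem theorem6 (K : fieldType) (X : choiceType) (X_nonempty : inhabited X) :
  ([pchar K]%R =i pred0 ->
     e_interpretable (ring_structure int)
                     (ring_structure (free_assoc_alg K X))) /\
  (forall p : nat, p \in [pchar K]%R ->
     e_interpretable (Z_add_dvd p)
                     (ring_structure (free_assoc_alg K X))).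
Proof.
case: X_nonempty => v; split=> [char0|p pK]; apply: (e_interpretable_int (v := v)).
- case.
  + exact: int_zero_definable.
  + exact: int_one_definable.
  + exact: int_opp_definable.
  + exact: int_add_definable.
  + exact: int_mul_definable.
- by case.
- by move=> s; exact: int_add_definable.
- by move=> s; exact: int_dvd_definable.
Qed.
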